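(* Let $\mathbb{F}$ be a field of characteristic zero, let $W_2$ be the conservative algebra over $\mathbb{F}$ of all commutative multiplications on a $2$-dimensional vector space, and let $S_2\subseteq W_2$ be the conservative algebra of all commutative multiplications with zero multiplication trace. Then every local derivation $S_2\to S_2$ of the algebra $S_2$ is a derivation of $S_2$, and every local derivation $W_2\to W_2$ of the algebra $W_2$ is a derivation of $W_2$.
   Context: Let $V_2$ be a $2$-dimensional vector space over $\mathbb{F}$ with a basis $v_1,v_2$. The algebra $W(2)$ is the $8$-dimensional vector space of all multiplications on $V_2$, i.e. all bilinear maps $V_2\times V_2\to V_2$, with the (nonassociative) product $$(A\cdot B)(x,y)=A(v_1,B(x,y))-B(A(v_1,x),y)-B(x,A(v_1,y)),\qquad x,y\in V_2,\ A,B\in W(2).$$ For $i,j,k\in\{1,2\}$ let $\alpha^k_{ij}\in W(2)$ be given by $\alpha^k_{ij}(v_t,v_l)=\delta_{it}\delta_{jl}v_k$. The subalgebra $W_2\subseteq W(2)$ is the $6$-dimensional subspace of all commutative (symmetric) multiplications. The subalgebra $S_2\subseteq W_2$ is the $4$-dimensional subspace of commutative multiplications with zero multiplication trace (every left multiplication operator has trace zero); it has basis $$e_1=\alpha^1_{11}-\alpha^2_{12}-\alpha^2_{21},\quad e_2=\alpha^2_{11},\quad e_3=\alpha^2_{22}-\alpha^1_{12}-\alpha^1_{21},\quad e_4=\alpha^1_{22}.$$ For a (not necessarily associative) $\mathbb{F}$-algebra $\mathcal{A}$: a linear map $D:\mathcal{A}\to\mathcal{A}$ is a derivation if $D(xy)=D(x)y+xD(y)$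 for all $x,y\in\mathcal{A}$. A linear map $\nabla:\mathcal{A}\to\mathcal{A}$ is a local derivation if for every $x\in\mathcal{A}$ there exists a derivation $D_x:\mathcal{A}\to\mathcal{A}$ (depending on $x$) such that $\nabla(x)=D_x(x)$. *)

(* Defs.v *)
From HB Require Import structures.
From mathcomp Require Import all_boot all_order all_algebra.
Set Implicit Arguments.
Unset Strict Implicit.
Unset Printing Implicit Defensive.
Import GRing.Theory passmx.
Local Open Scope ring_scope.

(* The multiplications on V are curried: A x is the left multiplication by x,  *)
(* and A x y is the product of x and y.                                       *)
Notation multiplication V := 'Hom(V, 'End(V)).

(* The product depends on a vector a of V, to be taken as the v_1 of a basis. *)
Section KantorProduct.
Variables (F : fieldType) (V : vectType F).
Implicit Types (A B : multiplication V) (a x y : V).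

Definition kantor_left a A B x : 'End(V) :=
  ((A a \o B x) - B (A a x) - (B x \o A a))%VF.

Fact kantor_left_linear a A B : linear (kantor_left a A B).
Proof.
move=> k x y; apply/lfunP => z; rewrite /kantor_left.
rewrite !(linearP, lfun_simp) /=.
by rewrite !scalerDr [RHS]addrACA; congr (_ + _); rewrite [RHS]addrACA.
Qed.

HB.instance Definition _ a A B :=
  GRing.isSemilinear.Build F V 'End(V) _ (kantor_left a A B)
    (GRing.semilinear_linear (kantor_left_linear a A B)).

Definition kantor_mul a A B : multiplication V := linfun (kantor_left a A B).

Lemma kantor_mulE a A B x y :
  kantor_mul a A B x y = A a (B x y) - B (A a x) y - B x (A a y).
Proof. by rewrite lfunE /= !lfun_simp. Qed.

End KantorProduct.

Section CommutativeMultiplications.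
Variables (F : fieldType) (V : vectType F).
Implicit Types (A B : multiplication V) (a x y : V) (f g : 'End(V)).

Definition right_mult A y x : V := A x y.

Fact right_mult_linear A y : linear (right_mult A y).
Proof. by move=> k x z; rewrite /right_mult linearP !lfun_simp. Qed.

HB.instance Definition _ A y :=
  GRing.isSemilinear.Build F V V _ (right_mult A y)
    (GRing.semilinear_linear (right_mult_linear A y)).

Definition opposite_left A x : 'End(V) := linfun (right_mult A x).

Fact opposite_left_linear A : linear (opposite_left A).
Proof.
move=> k x y; apply/lfunP => z.
by rewrite add_lfunE scale_lfunE !lfunE /= /right_mult linearP.
Qed.

HB.instance Definition _ A :=
  GRing.isSemilinear.Build F V 'End(V) _ (opposite_left A)
    (GRing.semilinear_linear (opposite_left_linear A)).

Definition opposite A : multiplication V := linfun (opposite_left A).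

Lemma oppositeE A x y : opposite A x y = A y x.
Proof. by rewrite !lfunE. Qed.

Fact opposite_linear : linear opposite.
Proof.
move=> k A B; apply/lfunP => x; apply/lfunP => y.
by rewrite !(lfun_simp, oppositeE).
Qed.

HB.instance Definition _ :=
  GRing.isSemilinear.Build F (multiplication V) (multiplication V) _ opposite
    (GRing.semilinear_linear opposite_linear).

Definition comm_multiplications : {vspace multiplication V} :=
  fixedSpace (linfun opposite).

Lemma comm_multiplicationsP A :
  reflect (forall x y, A x y = A y x) (A \in comm_multiplications).
Proof.
apply: (iffP fixedSpaceP) => [AC x y | AC].
  by rewrite -[in LHS]AC lfunE /= oppositeE.
by apply/lfunP => x; apply/lfunP => y; rewrite lfunE /= oppositeE.
Qed.

Definition lfun_trace f : F := \tr (mxof (vbasis {:V}) (vbasis {:V}) f).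

Fact lfun_trace_scalar : scalar lfun_trace.
Proof. by move=> k f g; rewrite /lfun_trace !linearP. Qed.

HB.instance Definition _ :=
  GRing.isSemilinear.Build F 'End(V) F _ lfun_trace
    (GRing.semilinear_linear lfun_trace_scalar).

Lemma lfun_trace_comp f g : lfun_trace (f \o g)%VF = lfun_trace (g \o f)%VF.
Proof.
have vV := vbasisP {:V}.
by rewrite /lfun_trace !(mxof_comp _ _ vV) // mxtrace_mulC.
Qed.

Lemma lfun_trace_basis n (e : n.-tuple V) f :
  basis_of {:V} e -> lfun_trace f = \sum_i coord e i (f e`_i).
Proof.
move=> eV; have vV := vbasisP {:V}.
have n_dim : n = \dim {:V} by apply: esym (size_basis eV).
subst n; rewrite /lfun_trace -[f in LHS]comp_lfun1r (mxof_comp _ _ eV).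
rewrite mxtrace_mulC -(mxof_comp _ _ vV) comp_lfun1l.
by apply: eq_bigr => i _; rewrite !mxE /= vecof_delta.
Qed.

Definition mult_trace_fun A x : F^o := lfun_trace (A x).

Fact mult_trace_fun_linear A : linear (mult_trace_fun A).
Proof. by move=> k x y; rewrite /mult_trace_fun !linearP. Qed.

HB.instance Definition _ A :=
  GRing.isSemilinear.Build F V F^o _ (mult_trace_fun A)
    (GRing.semilinear_linear (mult_trace_fun_linear A)).

Definition mult_trace A : 'Hom(V, F^o) := linfun (mult_trace_fun A).

Fact mult_trace_linear : linear mult_trace.
Proof.
move=> k A B; apply/lfunP => x.
by rewrite add_lfunE scale_lfunE !lfunE /= /mult_trace_fun !lfun_simp linearP.
Qed.

HB.instance Definition _ :=
  GRing.isSemilinear.Build F (multiplication V) 'Hom(V, F^o) _ mult_trace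
    (GRing.semilinear_linear mult_trace_linear).

Definition trace0_comm_multiplications : {vspace multiplication V} :=
  (comm_multiplications :&: lker (linfun mult_trace))%VS.

Lemma trace0_comm_multiplicationsP A :
  reflect ((forall x y, A x y = A y x) /\ (forall x, lfun_trace (A x) = 0))
          (A \in trace0_comm_multiplications).
Proof.
rewrite memv_cap memv_ker lfunE /=.
apply: (iffP andP) => -[].
  move=> /comm_multiplicationsP AC /eqP A0; split=> // x.
  by have := congr1 (fun f : 'Hom(V, F^o) => f x) A0; rewrite !lfunE.
move=> AC A0; split; first exact/comm_multiplicationsP.
by apply/eqP/lfunP => x; rewrite !lfunE /= /mult_trace_fun A0.
Qed.

Lemma kantor_mul_comm a A B :
  A \in comm_multiplications -> B \in comm_multiplications ->
  kantor_mul a A B \in comm_multiplications.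
Proof.
move=> _ /comm_multiplicationsP BC; apply/comm_multiplicationsP => x y.
by rewrite !kantor_mulE (BC x y) (BC _ y) (BC x) addrAC.
Qed.

Lemma kantor_mul_trace0_comm a A B :
  A \in trace0_comm_multiplications -> B \in trace0_comm_multiplications ->
  kantor_mul a A B \in trace0_comm_multiplications.
Proof.
move=> /trace0_comm_multiplicationsP[AC A0] /trace0_comm_multiplicationsP[BC B0].
apply/trace0_comm_multiplicationsP; split=> [|x].
  by apply/comm_multiplicationsP/kantor_mul_comm; apply/comm_multiplicationsP.
rewrite lfunE /= /kantor_left !linearB /= B0 lfun_trace_comp subr0.
exact: subrr.
Qed.

End CommutativeMultiplications.

Notation W_alg V := (subvs_of (comm_multiplications V)).
Notation S_alg V := (subvs_of (trace0_comm_multiplications V)).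

Section Algebras.
Variables (F : fieldType) (V : vectType F) (a : V).

Definition W_mul (A B : W_alg V) : W_alg V :=
  Subvs (kantor_mul_comm a (subvsP A) (subvsP B)).

Definition S_mul (A B : S_alg V) : S_alg V :=
  Subvs (kantor_mul_trace0_comm a (subvsP A) (subvsP B)).

End Algebras.

Section Derivations.
Variables (F : fieldType) (A : lmodType F) (mul : A -> A -> A).

Definition is_derivation (D : {linear A -> A}) : Prop :=
  forall x y, D (mul x y) = mul (D x) y + mul x (D y).

Definition is_local_derivation (nabla : {linear A -> A}) : Prop :=
  forall x, exists D : {linear A -> A}, is_derivation D /\ nabla x = D x.

End Derivations.

(* Main.v *)
(* Let u = alpha^2_11 and B11 = B(v1,v1), and let M be the space of all B with
   B11 = 0 and U the space of all B with B11 in F v1, so that the algebra is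
   F u + U. The structure constants show that every derivation maps U into M,
   and that a derivation D with D u in M vanishes. Given a local derivation
   nabla, choose a derivation D with nabla u = D u; for y in U choose
   derivations D1, D2 with nabla (u + y) = D1 (u + y) and nabla y = D2 y. Then
   (D1 - D) u = D2 y - D1 y is in M, hence D1 = D and nabla y = D y. So
   nabla = D. *)

Require Import Defs.
From HB Require Import structures.
From mathcomp Require Import all_boot all_order all_algebra.
From mathcomp Require Import ring.
Import GRing.Theory.
Local Open Scope ring_scope.

Set Implicit Arguments.
Unset Strict Implicit.
Unset Printing Implicit Defensive.

(** * Rigidity criterion for local derivations *)

Section LocalDerivations.
Variables (F : fieldType) (A : lmodType F) (mul : A -> A -> A).
Hypothesis mulBl : forall x y z, mul (x - y) z = mul x z - mul y z.
Hypothesis mulBr : forall x y z, mul z (x - y) = mul z x - mul z y.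

Lemma is_derivationB (D D' : {linear A -> A}) :
  is_derivation mul D -> is_derivation mul D' -> is_derivation mul (D \- D').
Proof. by move=> dD dD' x y; rewrite /= dD dD' mulBl mulBr opprD addrACA. Qed.

Lemma local_derivation_rigid (U M : A -> Prop) (u : A)
    (nabla : {linear A -> A}) :
    (forall y, exists k, exists2 z, U z & y = z + k *: u) ->
    (forall y z, M y -> M z -> M (y - z)) ->
    (forall (D : {linear A -> A}), is_derivation mul D ->
       forall y, U y -> M (D y)) ->
    (forall (D : {linear A -> A}), is_derivation mul D ->
       M (D u) -> forall y, D y = 0) ->
  is_local_derivation mul nabla -> is_derivation mul nabla.
Proof.
move=> UuT MB DU D0 nablaP.
have [D [dD nDu]] := nablaP u.
have nablaE_U y : U y -> nabla y = D y.
  move=> Uy; have [D1 [dD1 nD1]] := nablaP (u + y).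
  have [D2 [dD2 nD2]] := nablaP y.
  have D1D : (D1 \- D) u = D2 y - D1 y.
    apply/eqP; rewrite /= subr_eq addrAC -nD2 -nDu [_ + nabla u]addrC -linearD.
    by rewrite nD1 linearD addrK.
  have {}D1D : M ((D1 \- D) u) by rewrite D1D; apply: MB; apply: DU.
  have DE z : D1 z = D z.
    by apply/eqP; rewrite -subr_eq0; apply/eqP/(D0 _ (is_derivationB dD1 dD)).
  by apply: (addrI (nabla u)); rewrite -linearD nD1 DE nDu linearD.
have nablaE y : nabla y = D y.
  have [k [z Uz ->]] := UuT y.
  by rewrite !linearD !linearZ /= nDu nablaE_U.
by move=> x y; rewrite !nablaE.
Qed.

End LocalDerivations.

(** * Structure constants in coordinates *)

Section StructureConstants.
Variable F : fieldType.
Hypothesis char0 : forall n, n.+1%:R != 0 :> F.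

(* The record (p1, p2, q1, q2, r1, r2) stands for the commutative
   multiplication with v1 v1 = p1 v1 + p2 v2, v1 v2 = q1 v1 + q2 v2 and
   v2 v2 = r1 v1 + r2 v2. *)
Record coords := Coords {p1 : F; p2 : F; q1 : F; q2 : F; r1 : F; r2 : F}.

Definition add_coords (x y : coords) :=
  Coords (p1 x + p1 y) (p2 x + p2 y) (q1 x + q1 y) (q2 x + q2 y)
         (r1 x + r1 y) (r2 x + r2 y).

Definition scale_coords k (x : coords) :=
  Coords (k * p1 x) (k * p2 x) (k * q1 x) (k * q2 x) (k * r1 x) (k * r2 x).

(** Here [x] is the left factor A and [y] the right factor B. Only left multiplication by v1 of A
    enters, so [r1 x] and [r2 x] do not occur; the factor 2 comes from the commutativity of B. *)
Definition kantor_coords (x y : coords) :=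
  Coords
    (p1 y * p1 x + p2 y * q1 x - 2 * (p1 x * p1 y + p2 x * q1 y))
    (p1 y * p2 x + p2 y * q2 x - 2 * (p1 x * p2 y + p2 x * q2 y))
    (q1 y * p1 x + q2 y * q1 x - (p1 x * q1 y + p2 x * r1 y)
       - (q1 x * p1 y + q2 x * q1 y))
    (q1 y * p2 x + q2 y * q2 x - (p1 x * q2 y + p2 x * r2 y)
       - (q1 x * p2 y + q2 x * q2 y))
    (r1 y * p1 x + r2 y * q1 x - 2 * (q1 x * q1 y + q2 x * r1 y))
    (r1 y * p2 x + r2 y * q2 x - 2 * (q1 x * q2 y + q2 x * r2 y)).

(* The linear map given by the images of the multiplications with exactly one
   coordinate equal to 1, in the order of the fields of the record. *)
Definition lin_coords (a1 a2 b1 b2 c1 c2 x : coords) :=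
  add_coords (scale_coords (p1 x) a1)
    (add_coords (scale_coords (p2 x) a2)
      (add_coords (scale_coords (q1 x) b1)
        (add_coords (scale_coords (q2 x) b2)
          (add_coords (scale_coords (r1 x) c1) (scale_coords (r2 x) c2))))).

Definition coords_derivation a1 a2 b1 b2 c1 c2 (x y : coords) :=
  let D := lin_coords a1 a2 b1 b2 c1 c2 in
  D (kantor_coords x y) =
  add_coords (kantor_coords (D x) y) (kantor_coords x (D y)).

(** The certificate behind [derive]: given the multiplier, only a field identity is left to
    check. *)
Lemma eq_of_multiple (k x y l r : F) : l = r -> x - y = k * (l - r) -> x = y.
Proof. by move=> -> /eqP; rewrite subrr mulr0 subr_eq0 => /eqP. Qed.

Local Notation u1 := (Coords 1 0 0 0 0 0).
Local Notation u2 := (Coords 0 1 0 0 0 0).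
Local Notation u3 := (Coords 0 0 1 0 0 0).
Local Notation u4 := (Coords 0 0 0 1 0 0).
Local Notation u5 := (Coords 0 0 0 0 1 0).
Local Notation u6 := (Coords 0 0 0 0 0 1).

(* Proves an equation that is c times the k-coordinate of H, once H has been
   simplified with the given rules. *)
Tactic Notation "derive" constr(H) "at" constr(k) "times" uconstr(c)
    "using" constr(rules) :=
  let E := fresh in
  have E := congr1 k H; rewrite /kantor_coords /lin_coords /= in E;
  rewrite ?rules ?(mulr0, mulr1, mul0r, mul1r, oppr0, addr0, add0r) in E;
  refine (@eq_of_multiple c _ _ _ _ E _); field; rewrite ?char0 //.

Tactic Notation "derive" constr(H) "at" constr(k) "times" uconstr(c) :=
  derive H at k times c using addr0.

(** * Derivations of W_2 *)

Section DerivationsOfW.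
Variables a1 a2 b1 b2 c1 c2 : coords.
Hypothesis dD : forall x y, coords_derivation a1 a2 b1 b2 c1 c2 x y.

(** Left multiplication by [u5] is zero, so 0 = D (u5 . y) = (D u5) . y for all y. Testing y = [u1],
    [u2] kills the coordinates of D u5 that act from the left. The same holds for [u6]. *)
Lemma W_der_c1 : (p1 c1 = 0) * (p2 c1 = 0) * (q1 c1 = 0) * (q2 c1 = 0).
Proof.
have p1c1 : p1 c1 = 0 by derive (dD u5 u1) at p1 times 1.
do !split => //.
- derive (dD u5 u1) at p2 times (-1).
- derive (dD u5 u1) at q1 times 1.
- derive (dD u5 u2) at p2 times (-1) using p1c1.
Qed.

Lemma W_der_c2 : (p1 c2 = 0) * (p2 c2 = 0) * (q1 c2 = 0) * (q2 c2 = 0).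
Proof.
have p1c2 : p1 c2 = 0 by derive (dD u6 u1) at p1 times 1.
do !split => //.
- derive (dD u6 u1) at p2 times (-1).
- derive (dD u6 u1) at q1 times 1.
- derive (dD u6 u2) at p2 times (-1) using p1c2.
Qed.

(** Left multiplications by [u1] and [u4] are diagonal, with eigenvalues (-1, -2, 0, -1, 1, 0) and
    (0, 1, -1, 0, -2, -1) on [u1], ..., [u6]. Applying D to such eigenvector relations, here u1 . u1
    = - u1, yields most of the equations below. *)
Lemma W_der_a1 : (p1 a1 = 0) * (r1 a1 = 0) * (r2 a1 = 0).
Proof.
do !split.
- derive (dD u1 u1) at p1 times 1.
- derive (dD u1 u1) at r1 times (- 1 / 2).
- derive (dD u1 u1) at r2 times (-1).
Qed.

Lemma W_der_b2 : (p1 b2 = 0) * (p2 b2 = 0) * (q1 b2 = - q1 a1) *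
  (q2 b2 = 0) * (r1 b2 = 0) * (r2 b2 = q1 a1 + q1 a1).
Proof.
have q1b2 : q1 b2 = - q1 a1 by derive (dD u4 u1) at q1 times 1.
have p1b2 : p1 b2 = 0 by derive (dD u4 u1) at p1 times 1.
do !split => //.
- derive (dD u4 u4) at p2 times 1.
- derive (dD u4 u2) at p2 times (-1) using p1b2.
- derive (dD u4 u4) at r1 times (1 / 2).
- derive (dD u4 u4) at r2 times 1 using q1b2.
Qed.

(** These two coordinates cancel in the equation from u1 . u1 = - u1; the relations u4 . u1 = 0 and
    u1 . u2 = - 2 u2 detect them. *)
Lemma W_der_a1' : (p2 a1 = 0) * (q2 a1 = 0).
Proof.
split.
- derive (dD u4 u1) at p2 times (-1) using W_der_b2.
- derive (dD u1 u2) at p2 times (-1) using W_der_a1.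
Qed.

Lemma W_der_b1 : (p1 b1 = 0) * (p2 b1 = 0) * (q2 b1 = 0) *
  (r1 b1 = q1 a1 + q1 a1).
Proof.
do !split.
- derive (dD u4 u3) at p1 times (-1) using W_der_b2.
- derive (dD u4 u3) at p2 times (- 1 / 2) using W_der_b2.
- derive (dD u4 u3) at q2 times (-1) using W_der_b2.
- derive (dD u4 u3) at r1 times 1 using W_der_b2.
Qed.

Definition W_derE :=
  (W_der_a1, W_der_a1', W_der_b1, W_der_b2, W_der_c1, W_der_c2).

(** An endomorphism of V with v1 -> 0 and v2 -> s v1 + k v2 induces a derivation D for which s and k
    are the coordinates [p1] and [p2] of D u2. The lemma says that no derivation escapes these two
    parameters. *)
Lemma W_der_eq0 : p1 a2 = 0 -> p2 a2 = 0 ->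
  forall x, lin_coords a1 a2 b1 b2 c1 c2 x = Coords 0 0 0 0 0 0.
Proof.
move=> p1a2 p2a2.
have q1a1 : q1 a1 = 0.
  by derive (dD u1 u2) at p1 times (-1) using (W_derE, p1a2).
have {q1a1}DE := (W_derE, q1a1, p1a2, p2a2).
(* Now D u1 = 0, so D u2 is an eigenvector of left multiplication by [u1] for -2, while the
   eigenvalues on [u3], ..., [u6] are 0, -1, 1, 0. *)
have a2E : (q1 a2 = 0) * (q2 a2 = 0) * (r1 a2 = 0) * (r2 a2 = 0).
  do !split.
  - derive (dD u1 u2) at q1 times (- 1 / 2) using DE.
  - derive (dD u1 u2) at q2 times (-1) using DE.
  - derive (dD u1 u2) at r1 times (- 1 / 3) using DE.
  - derive (dD u1 u2) at r2 times (- 1 / 2) using DE.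
have {a2E}DE := (a2E, DE).
(* D kills [u1], [u2] and [u4]; the rest follows from u2 . u3 = - 2 u1 + u4 and u2 . u5 = u6 -
   u3. *)
have q1b1 : q1 b1 = 0 by derive (dD u2 u3) at p1 times (1 / 2) using DE.
have r2b1 : r2 b1 = 0 by derive (dD u2 u3) at q2 times 1 using (q1b1, DE).
have r1c1 : r1 c1 = 0 by derive (dD u2 u5) at q1 times 1 using (q1b1, DE).
have r2c1 : r2 c1 = 0 by derive (dD u2 u5) at q2 times 1 using DE.
have r1c2 : r1 c2 = 0 by derive (dD u2 u5) at r1 times 1 using DE.
have r2c2 : r2 c2 = 0.
  by derive (dD u2 u5) at r2 times 1 using (r1c1, r2b1, DE).
move=> x; rewrite /lin_coords /add_coords /=.
rewrite !(q1b1, r2b1, r1c1, r2c1, r1c2, r2c2, DE).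
by rewrite !(oppr0, addr0, mulr0).
Qed.

(** Among the images of the six basis elements, only that of [u2] can have nonzero [p1] or [p2]. *)
Lemma W_der_ker x : p2 x = 0 ->
  let Dx := lin_coords a1 a2 b1 b2 c1 c2 x in (p1 Dx = 0) /\ (p2 Dx = 0).
Proof. by move=> x0; rewrite /= !W_derE x0 !(mulr0, mul0r, addr0). Qed.

End DerivationsOfW.

(** * Derivations of S_2 *)

Section DerivationsOfS.

(** Left multiplications by v2 and v1 have traces q1 + r2 and p1 + q2. *)
Definition trace0_coords x := q1 x = - r2 x /\ q2 x = - p1 x.

Local Notation e1 := (Coords 1 0 0 (-1) 0 0).
Local Notation e2 := (Coords 0 1 0 0 0 0).
Local Notation e3 := (Coords 0 0 (-1) 0 0 1).
Local Notation e4 := (Coords 0 0 0 0 1 0).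

Variables d1 d2 d3 d4 : coords.
Hypothesis d_trace0 : [/\ trace0_coords d1, trace0_coords d2,
  trace0_coords d3 & trace0_coords d4].
(* A multiplication in S_2 is p1 e1 + p2 e2 + r1 e4 + r2 e3, so the
   coordinates q1 and q2 contribute nothing to its image. *)
Let z := Coords 0 0 0 0 0 0.
Local Notation D := (lin_coords d1 d2 z z d4 d3).
Hypothesis dD : forall x y, trace0_coords x -> trace0_coords y ->
  coords_derivation d1 d2 z z d4 d3 x y.

Lemma e1_trace0 : trace0_coords e1. Proof. by split; rewrite /= ?oppr0. Qed.
Lemma e2_trace0 : trace0_coords e2. Proof. by split; rewrite /= ?oppr0. Qed.
Lemma e3_trace0 : trace0_coords e3. Proof. by split; rewrite /= ?oppr0. Qed.
Lemma e4_trace0 : trace0_coords e4. Proof. by split; rewrite /= ?oppr0. Qed.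

Let dE : (q1 d1 = - r2 d1) * (q2 d1 = - p1 d1) *
  (q1 d2 = - r2 d2) * (q2 d2 = - p1 d2) *
  (q1 d3 = - r2 d3) * (q2 d3 = - p1 d3) *
  (q1 d4 = - r2 d4) * (q2 d4 = - p1 d4).
Proof. by case: d_trace0 => -[? ?] [? ?] [? ?] [? ?]; do !split. Qed.

(** Left multiplication by [e1] is diagonal on S_2, with eigenvalues -1, -3, 1, 3 on [e1], [e2],
    [e3], [e4]. Here D is applied to e1 . e1 = - e1, which leaves D e1 a multiple of [e3]. *)
Lemma S_der_d1 : (p1 d1 = 0) * (p2 d1 = 0) * (r1 d1 = 0).
Proof.
do !split.
- derive (dD e1_trace0 e1_trace0) at p1 times 1 using dE.
- derive (dD e1_trace0 e1_trace0) at p2 times (-1) using dE.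
- derive (dD e1_trace0 e1_trace0) at r1 times (- 1 / 4) using dE.
Qed.

Lemma S_der_d3 : (p1 d3 = 0) * (p2 d3 = 0).
Proof.
split.
- derive (dD e1_trace0 e3_trace0) at p1 times (1 / 2) using (S_der_d1, dE).
- derive (dD e1_trace0 e3_trace0) at p2 times (1 / 4) using (S_der_d1, dE).
Qed.

(** Left multiplication by [e4] is zero, so (D e4) . e1 = 0, whereas [e1], [e2], [e3] times [e1] are
    - e1, 3 e2, - 2 e3. *)
Lemma S_der_d4 : (p1 d4 = 0) * (p2 d4 = 0) * (r2 d4 = 0).
Proof.
do !split.
- derive (dD e4_trace0 e1_trace0) at p1 times 1 using (S_der_d1, dE).
- derive (dD e4_trace0 e1_trace0) at p2 times (- 1 / 3) using (S_der_d1, dE).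
- derive (dD e4_trace0 e1_trace0) at r2 times (1 / 2) using (S_der_d1, dE).
Qed.

Lemma S_der_eq0 : p1 d2 = 0 -> p2 d2 = 0 ->
  forall x, D x = Coords 0 0 0 0 0 0.
Proof.
move=> p1d2 p2d2.
have DE := (S_der_d1, S_der_d3, S_der_d4, p1d2, p2d2, dE).
(* The relation e1 . e2 = - 3 e2 gives D e1 = 0 and then D e2 = 0 by comparing eigenvalues. The
   remaining relations are e1 . e3 = e3, e3 . e2 = - e1 and e2 . e4 = e3. *)
have r2d1 : r2 d1 = 0.
  by derive (dD e1_trace0 e2_trace0) at p1 times 1 using DE.
have r1d2 : r1 d2 = 0.
  by derive (dD e1_trace0 e2_trace0) at r1 times (- 1 / 6) using DE.
have r2d2 : r2 d2 = 0.
  by derive (dD e1_trace0 e2_trace0) at r2 times (- 1 / 4) using DE.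
have r1d3 : r1 d3 = 0.
  by derive (dD e1_trace0 e3_trace0) at r1 times (- 1 / 2) using (r2d1, DE).
have r2d3 : r2 d3 = 0.
  by derive (dD e3_trace0 e2_trace0) at p1 times 1 using (r2d1, r2d2, DE).
have r1d4 : r1 d4 = 0.
  by derive (dD e2_trace0 e4_trace0) at r2 times (-1) using (r2d3, r2d2, DE).
move=> x; rewrite /lin_coords /add_coords /=.
rewrite !(r2d1, r1d2, r2d2, r1d3, r2d3, r1d4, DE).
by rewrite !(oppr0, addr0, mulr0).
Qed.

Lemma S_der_ker x : p2 x = 0 -> (p1 (D x) = 0) /\ (p2 (D x) = 0).
Proof.
move=> x0; rewrite /= !(S_der_d1, S_der_d3, S_der_d4) x0.
by rewrite !(mulr0, mul0r, addr0).
Qed.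

End DerivationsOfS.

End StructureConstants.

(** * Passage between multiplications and coordinates *)

Section Coordinates.
Variables (F : fieldType) (V : vectType F) (v1 v2 : V).
Hypothesis v_basis : basis_of fullv [:: v1; v2].

Let v : 2.-tuple V := [tuple of [:: v1; v2]].
Local Notation c1 := (coord v 0).
Local Notation c2 := (coord v 1).

Lemma coord_v : ((c1 v1 = 1) * (c1 v2 = 0)) * ((c2 v1 = 0) * (c2 v2 = 1)).
Proof.
have fv : free v by exact: basis_free v_basis.
have E i j : coord v i v`_(j : 'I_2) = (j == i)%:R by rewrite coord_free.
by do !split; [exact: E 0 0 | exact: E 0 1 | exact: E 1 0 | exact: E 1 1].
Qed.

Lemma coord_sum x : x = c1 x *: v1 + c2 x *: v2.
Proof.
rewrite {1}(coord_basis (X := v) v_basis (memvf x)).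
rewrite !big_ord_recl big_ord0 addr0.
by rewrite (_ : lift ord0 ord0 = 1) //; exact: val_inj.
Qed.

Definition two_images_fun (W : vectType F) (w1 w2 : W) x :=
  c1 x *: w1 + c2 x *: w2.

Fact two_images_linear (W : vectType F) (w1 w2 : W) :
  linear (two_images_fun w1 w2).
Proof.
move=> k x y; rewrite /two_images_fun scalerDr !scalerA.
by rewrite addrACA -!scalerDl !linearP.
Qed.

HB.instance Definition _ (W : vectType F) (w1 w2 : W) :=
  GRing.isSemilinear.Build F V W _ (two_images_fun w1 w2)
    (GRing.semilinear_linear (two_images_linear w1 w2)).

Definition two_images (W : vectType F) (w1 w2 : W) : 'Hom(V, W) :=
  linfun (two_images_fun w1 w2).

Lemma two_images_coord (W : vectType F) (w1 w2 : W) x :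
  two_images w1 w2 x = c1 x *: w1 + c2 x *: w2.
Proof. exact: lfunE. Qed.

Lemma two_imagesE (W : vectType F) (w1 w2 : W) :
  (two_images w1 w2 v1 = w1) * (two_images w1 w2 v2 = w2).
Proof.
by rewrite !two_images_coord !coord_v !scale1r !scale0r addr0 add0r.
Qed.

Lemma lfun_eq_basis (W : vectType F) (f g : 'Hom(V, W)) :
  f v1 = g v1 -> f v2 = g v2 -> f = g.
Proof.
move=> fg1 fg2; apply/lfunP => x.
by rewrite (coord_sum x) !linearD !linearZ /= fg1 fg2.
Qed.

Lemma lfun_trace2 (f : 'End(V)) : lfun_trace f = c1 (f v1) + c2 (f v2).
Proof.
rewrite (@lfun_trace_basis _ _ _ v) // !big_ord_recl big_ord0 addr0.
by rewrite (_ : lift ord0 ord0 = 1) //; exact: val_inj.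
Qed.

Definition coords_of (B : multiplication V) : coords F :=
  Coords (c1 (B v1 v1)) (c2 (B v1 v1)) (c1 (B v1 v2)) (c2 (B v1 v2))
         (c1 (B v2 v2)) (c2 (B v2 v2)).

Lemma coords_ofD A B :
  coords_of (A + B) = add_coords (coords_of A) (coords_of B).
Proof. by rewrite /coords_of !add_lfunE !linearD. Qed.

Lemma coords_ofZ k B : coords_of (k *: B) = scale_coords k (coords_of B).
Proof. by rewrite /coords_of !scale_lfunE !linearZ. Qed.

Lemma coords_of0 : coords_of 0 = Coords 0 0 0 0 0 0.
Proof. by rewrite /coords_of !zero_lfunE !linear0. Qed.

Lemma coords_of_inj A B :
    A \in comm_multiplications V -> B \in comm_multiplications V ->
  coords_of A = coords_of B -> A = B.
Proof.
move=> /comm_multiplicationsP AC /comm_multiplicationsP BC [e1 e2 e3 e4 e5 e6].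
have vP x y : c1 x = c1 y -> c2 x = c2 y -> x = y.
  by move=> xy1 xy2; rewrite (coord_sum x) (coord_sum y) xy1 xy2.
apply: lfun_eq_basis; apply: lfun_eq_basis; rewrite ?(AC v2) ?(BC v2).
all: exact: vP.
Qed.

Lemma coords_kantor A B : B \in comm_multiplications V ->
  coords_of (kantor_mul v1 A B) = kantor_coords (coords_of A) (coords_of B).
Proof.
move=> /comm_multiplicationsP BC.
have AE x : A v1 x = c1 x *: A v1 v1 + c2 x *: A v1 v2.
  by rewrite {1}(coord_sum x) linearD !linearZ.
have BE x y : B (A v1 x) y = c1 (A v1 x) *: B v1 y + c2 (A v1 x) *: B v2 y.
  by rewrite {1}(coord_sum (A v1 x)) linearD !linearZ add_lfunE !scale_lfunE.
have cE k a b x y :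
    coord v k (a *: x + b *: y) = a * coord v k x + b * coord v k y.
  by rewrite linearD !linearZ.
have cB k x y z :
    coord v k (x - y - z) = coord v k x - coord v k y - coord v k z.
  by rewrite !linearB.
rewrite /coords_of /kantor_coords /= !kantor_mulE !cB.
(* Commutativity moves the values of A v1 into the first argument of B, where [BE] expands them. *)
rewrite (BC v1 (A v1 v1)) (BC v1 (A v1 v2)) (BC v2 (A v1 v2)).
rewrite !(AE (B _ _)) !BE !cE !(BC v2 v1).
by congr Coords; ring.
Qed.

Definition mult_of_coords (x : coords F) : multiplication V :=
  let p := p1 x *: v1 + p2 x *: v2 in
  let q := q1 x *: v1 + q2 x *: v2 in
  let r := r1 x *: v1 + r2 x *: v2 in
  two_images (two_images p q) (two_images q r).

Lemma mult_of_coordsK : cancel mult_of_coords coords_of.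
Proof.
case=> *; rewrite /coords_of /mult_of_coords /= !two_imagesE !linearD !linearZ.
by rewrite /= !coord_v !mulr0 !mulr1 !addr0 !add0r.
Qed.

Lemma mult_of_coords_comm x : mult_of_coords x \in comm_multiplications V.
Proof.
apply/comm_multiplicationsP => y z; rewrite /mult_of_coords.
rewrite (two_images_coord _ _ y) (two_images_coord _ _ z).
rewrite !(add_lfunE, scale_lfunE) !two_images_coord.
rewrite !scalerDr !scalerA [c1 z * c1 y]mulrC [c2 z * c2 y]mulrC.
by rewrite [c1 z * c2 y]mulrC [c2 z * c1 y]mulrC addrACA.
Qed.

Lemma trace0_coordsP B : B \in comm_multiplications V ->
  reflect (trace0_coords (coords_of B)) (B \in trace0_comm_multiplications V).
Proof.
move=> /comm_multiplicationsP BC; rewrite /trace0_coords /=.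
apply: (iffP (trace0_comm_multiplicationsP _)) => [[_ B0] | [B2 B1]].
  have := B0 v1; have := B0 v2; rewrite !lfun_trace2 (BC v2 v1) => B2 B1.
  split; apply/eqP; rewrite -addr_eq0; apply/eqP => //.
  by rewrite addrC.
split=> // x; rewrite (coord_sum x) !linearD !linearZ /= !lfun_trace2.
by rewrite (BC v2 v1) B1 B2 subrr addNr !mulr0 addr0.
Qed.

Lemma kantor_mulBl a (A B C : multiplication V) :
  kantor_mul a (A - B) C = kantor_mul a A C - kantor_mul a B C.
Proof.
apply/lfunP => x; apply/lfunP => y.
rewrite !(kantor_mulE, add_lfunE, opp_lfunE) !linearB /=.
rewrite !(add_lfunE, opp_lfunE).
by rewrite !opprD !opprK [X in X + _ = _]addrACA [LHS]addrACA.
Qed.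

Lemma kantor_mulBr a (A B C : multiplication V) :
  kantor_mul a C (A - B) = kantor_mul a C A - kantor_mul a C B.
Proof.
apply/lfunP => x; apply/lfunP => y.
rewrite !(kantor_mulE, add_lfunE, opp_lfunE) !linearB /=.
by rewrite [X in X + _ = _]addrACA [LHS]addrACA.
Qed.

(** * Local derivations of a subalgebra of W_2 *)

Section Subalgebra.
Variables (K : {vspace multiplication V}).
Variables (mul : subvs_of K -> subvs_of K -> subvs_of K).
Hypothesis K_comm : (K <= comm_multiplications V)%VS.
Hypothesis mulE : forall X Y,
  vsval (mul X Y) = kantor_mul v1 (vsval X) (vsval Y).
Lemma subalgebra_comm (X : subvs_of K) : vsval X \in comm_multiplications V.
Proof. exact: (subvP K_comm _ (subvsP X)). Qed.

Variables X1 X2 X3 X4 X5 X6 : subvs_of K.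

(** The family is meant to span [K] with the six coordinates as coefficients, without being
    independent: this lets S_2 be treated along with W_2, by taking [X3] and [X4] to be 0. *)
Definition lin_comb (x : coords F) := p1 x *: X1 + (p2 x *: X2 + (q1 x *: X3 +
  (q2 x *: X4 + (r1 x *: X5 + r2 x *: X6)))).

Let phi (X : subvs_of K) := coords_of (vsval X).

Let phiD X Y : phi (X + Y) = add_coords (phi X) (phi Y).
Proof. exact: coords_ofD. Qed.

Let phiZ k X : phi (k *: X) = scale_coords k (phi X).
Proof. exact: coords_ofZ. Qed.

Lemma coords_lin_comb x : coords_of (vsval (lin_comb x)) =
  lin_coords (coords_of (vsval X1)) (coords_of (vsval X2))
    (coords_of (vsval X3)) (coords_of (vsval X4)) (coords_of (vsval X5))
    (coords_of (vsval X6)) x.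
Proof. by rewrite -[LHS]/(phi _) /lin_comb !phiD !phiZ. Qed.

Hypothesis expand : forall X, X = lin_comb (coords_of (vsval X)).

Lemma phi_linear (f : {linear subvs_of K -> subvs_of K}) X : phi (f X) =
  lin_coords (phi (f X1)) (phi (f X2)) (phi (f X3)) (phi (f X4)) (phi (f X5))
    (phi (f X6)) (phi X).
Proof.
by rewrite {1}[X]expand /lin_comb !(linearD f) !(linearZZ f) !phiD !phiZ.
Qed.

Lemma phi_derivation (D : {linear subvs_of K -> subvs_of K}) X Y :
  is_derivation mul D ->
  coords_derivation (phi (D X1)) (phi (D X2)) (phi (D X3)) (phi (D X4))
    (phi (D X5)) (phi (D X6)) (phi X) (phi Y).
Proof.
move=> dD; rewrite /coords_derivation -!phi_linear.
rewrite -coords_kantor ?subalgebra_comm // -mulE -[coords_of _]/(phi _).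
rewrite -phi_linear dD phiD /phi !mulE.
by rewrite !coords_kantor ?subalgebra_comm.
Qed.

(** The bridge from the rigidity criterion to the coordinate computations, shared by both algebras:
    U is given by p2 = 0 and M by p1 = p2 = 0. *)
Lemma local_derivation_subalgebra u
    (nabla : {linear subvs_of K -> subvs_of K}) :
    phi u = Coords 0 1 0 0 0 0 ->
    (forall (D : {linear subvs_of K -> subvs_of K}), is_derivation mul D ->
       forall X, p2 (phi X) = 0 -> p1 (phi (D X)) = 0 /\ p2 (phi (D X)) = 0) ->
    (forall (D : {linear subvs_of K -> subvs_of K}), is_derivation mul D ->
       p1 (phi (D u)) = 0 -> p2 (phi (D u)) = 0 ->
       forall X, phi (D X) = Coords 0 0 0 0 0 0) ->
  is_local_derivation mul nabla -> is_derivation mul nabla.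
Proof.
move=> uE Dker D0.
have phiB X Y : phi (X - Y) = add_coords (phi X) (scale_coords (- 1) (phi Y)).
  by rewrite -scaleN1r phiD phiZ.
apply: (@local_derivation_rigid _ _ mul _ _ (fun X => p2 (phi X) = 0)
  (fun X => p1 (phi X) = 0 /\ p2 (phi X) = 0) u).
- move=> X Y Z; apply: val_inj; rewrite [LHS]mulE.
  rewrite -[RHS]/(vsval _ - vsval _) !mulE.
  exact: kantor_mulBl.
- move=> X Y Z; apply: val_inj; rewrite [LHS]mulE.
  rewrite -[RHS]/(vsval _ - vsval _) !mulE.
  exact: kantor_mulBr.
- move=> Y; exists (p2 (phi Y)), (Y - p2 (phi Y) *: u); last by rewrite subrK.
  by rewrite phiB phiZ uE /= mulr1 mulN1r subrr.
- move=> Y Z; rewrite phiB; move: (phi Y) (phi Z) => y z [y1 y2] [z1 z2] /=.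
  by rewrite y1 y2 z1 z2 !mulr0 addr0.
- exact: Dker.
- move=> D dD [D1 D2] X.
  apply/val_inj/coords_of_inj; rewrite ?subalgebra_comm //.
  by rewrite -[coords_of _]/(phi _) D0 // coords_of0.
Qed.

End Subalgebra.

(** * Local derivations of W_2 and S_2 *)

Hypothesis char0 : forall n, n.+1%:R != 0 :> F.

Definition W_of x : W_alg V := Subvs (mult_of_coords_comm x).

Lemma W_local_derivation (nabla : {linear W_alg V -> W_alg V}) :
  is_local_derivation (W_mul v1) nabla -> is_derivation (W_mul v1) nabla.
Proof.
pose X1 := W_of (Coords 1 0 0 0 0 0); pose X2 := W_of (Coords 0 1 0 0 0 0).
pose X3 := W_of (Coords 0 0 1 0 0 0); pose X4 := W_of (Coords 0 0 0 1 0 0).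
pose X5 := W_of (Coords 0 0 0 0 1 0); pose X6 := W_of (Coords 0 0 0 0 0 1).
have expand X : X = lin_comb X1 X2 X3 X4 X5 X6 (coords_of (vsval X)).
  apply/val_inj/coords_of_inj; rewrite ?subvsP // coords_lin_comb.
  rewrite !mult_of_coordsK; case: (coords_of _) => *.
  by rewrite /lin_coords /add_coords /= !(mulr0, mulr1, addr0, add0r).
have mulE X Y : vsval (W_mul v1 X Y) = kantor_mul v1 (vsval X) (vsval Y) by [].
have sub := subvv (comm_multiplications V).
have dD D (dD : is_derivation (W_mul v1) D) x y :=
  phi_derivation sub mulE expand (W_of x) (W_of y) dD.
apply: (local_derivation_subalgebra sub mulE (u := X2)).
- exact: mult_of_coordsK.
- move=> D /dD{}dD X X0; rewrite (phi_linear expand).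
  by apply: W_der_ker X0 => // x y; have := dD x y; rewrite !mult_of_coordsK.
- move=> D /dD{}dD D1 D2 X; rewrite (phi_linear expand).
  by apply: W_der_eq0 => // x y; have := dD x y; rewrite !mult_of_coordsK.
Qed.

Lemma mult_of_coords_trace0 x : trace0_coords x ->
  mult_of_coords x \in trace0_comm_multiplications V.
Proof.
move=> x0; apply/trace0_coordsP; first exact: mult_of_coords_comm.
by rewrite mult_of_coordsK.
Qed.

Definition S_of x (x0 : trace0_coords x) : S_alg V :=
  Subvs (mult_of_coords_trace0 x0).

Lemma S_local_derivation (nabla : {linear S_alg V -> S_alg V}) :
  is_local_derivation (S_mul v1) nabla -> is_derivation (S_mul v1) nabla.
Proof.
pose X1 := S_of (e1_trace0 F); pose X2 := S_of (e2_trace0 F).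
pose X3 := S_of (e3_trace0 F); pose X4 := S_of (e4_trace0 F).
have sub : (trace0_comm_multiplications V <= comm_multiplications V)%VS.
  exact: capvSl.
have S_trace0 (X : S_alg V) : trace0_coords (coords_of (vsval X)).
  by apply/trace0_coordsP; rewrite ?subvsP // (subalgebra_comm sub).
(* [X4] precedes [X3] because [r1] is the coefficient of e4 and [r2] that of e3. *)
have expand X : X = lin_comb X1 X2 0 0 X4 X3 (coords_of (vsval X)).
  apply/val_inj/coords_of_inj; rewrite ?(subalgebra_comm sub) //.
  rewrite coords_lin_comb.
  rewrite !mult_of_coordsK coords_of0.
  have [+ +] := S_trace0 X; case: (coords_of _) => /= p1 p2 q1 q2 r1 r2 -> ->.
  rewrite /lin_coords /add_coords /=.
  by rewrite !(mulr0, mulr1, mulrN1, addr0, add0r).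
have mulE X Y : vsval (S_mul v1 X Y) = kantor_mul v1 (vsval X) (vsval Y) by [].
have dD D (dD : is_derivation (S_mul v1) D) x y x0 y0 :=
  phi_derivation sub mulE expand (@S_of x x0) (@S_of y y0) dD.
have phi0 D : coords_of (vsval ((D : {linear S_alg V -> S_alg V}) 0)) =
    Coords 0 0 0 0 0 0.
  by rewrite (linear0 D) coords_of0.
apply: (local_derivation_subalgebra sub mulE (u := X2)).
- exact: mult_of_coordsK.
- move=> D /dD{}dD X X0; rewrite (phi_linear expand) phi0.
  apply: S_der_ker X0 => // x y x0 y0.
  by have := dD x y x0 y0; rewrite !mult_of_coordsK phi0.
- move=> D /dD{}dD D1 D2 X; rewrite (phi_linear expand) phi0.
  apply: S_der_eq0 => // x y x0 y0.
  by have := dD x y x0 y0; rewrite !mult_of_coordsK phi0.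
Qed.

End Coordinates.

Theorem corollary3p2 (F : fieldType) (V : vectType F) (v1 v2 : V)
    (char0 : [pchar F] =i pred0) (v_basis : basis_of fullv [:: v1; v2]) :
  (forall nabla : {linear S_alg V -> S_alg V},
     is_local_derivation (S_mul v1) nabla -> is_derivation (S_mul v1) nabla) /\
  (forall nabla : {linear W_alg V -> W_alg V},
     is_local_derivation (W_mul v1) nabla -> is_derivation (W_mul v1) nabla).
Proof.
have natS_neq0 n : n.+1%:R != 0 :> F by rewrite ((pcharf0P F).1 char0).
split=> nabla; first exact: (S_local_derivation v_basis natS_neq0).
exact: (W_local_derivation v_basis natS_neq0).
Qed.
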